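(* Let $\mathcal{L}_1=(S_1,\iota_1,\rightarrow_1)$ and $\mathcal{L}_2=(S_2,\iota_2,\rightarrow_2)$ be two LTSs. Then $\mathcal{L}_1\sqsubseteq_{\mathsf{fdr}}\mathcal{L}_2$ holds if and only if no FD-witness is reachable in $\mathsf{norm}_{\mathsf{fdr}}(\mathcal{L}_1)\ltimes\mathcal{L}_2$.
   Context: Fix a finite set $\mathit{Act}$ of actions not containing the internal action $\tau$; $\mathit{Act}_\tau=\mathit{Act}\cup\{\tau\}$. An LTS is $(S,\iota,\rightarrow)$ with $\iota\in S$ and $\rightarrow\subseteq S\times\mathit{Act}_\tau\times S$; $\mathsf{enabled}(s)=\{a\in\mathit{Act}_\tau\mid\exists t: s\xrightarrow{a}t\}$. For $\sigma\in\mathit{Act}_\tau^*$, $s\overset{\sigma}{\twoheadrightarrow}t$ means there is a path from $s$ to $t$ whose labels, in order, form exactly $\sigma$; a state is reachable in an LTS if $\iota\overset{\sigma}{\twoheadrightarrow}$ it for some $\sigma\in\mathit{Act}_\tau^*$. The weak transition relation $\Longrightarrow\subseteq S\times\mathit{Act}^*\times S$ is the smallest relation with $s\overset{\epsilon}{\Longrightarrow}s$; $s\overset{\epsilon}{\Longrightarrow}t$ if $s\xrightarrow{\tau}t$; $s\overset{a}{\Longrightarrow}t$ if $s\xrightarrow{a}t$ ($a\in\mathit{Act}$); $s\overset{\rho\sigma}{\Longrightarrow}t$ if $s\overset{\rho}{\Longrightarrow}u\overset{\sigma}{\Longrightarrow}t$. A state $s$ is stable if $\tau\notin\mathsf{enabled}(s)$;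 for stable $s$, $\mathsf{refusals}(s)=\mathcal{P}(\mathit{Act}\setminus\mathsf{enabled}(s))$; for a set of states $U$, $\mathsf{refusals}(U)=\{X\subseteq\mathit{Act}\mid\exists s\in U: s\text{ stable}\wedge X\in\mathsf{refusals}(s)\}$. A state $s$ diverges if there is an infinite sequence $s\xrightarrow{\tau}s_1\xrightarrow{\tau}s_2\xrightarrow{\tau}\cdots$; a set $U$ diverges if some state of $U$ diverges. $\mathsf{divergences}(\mathcal{L})=\{\rho\sigma\in\mathit{Act}^*\mid\exists t:\iota\overset{\rho}{\Longrightarrow}t\wedge t\text{ diverges}\}$. $\mathsf{failures}(\mathcal{L})=\{(\rho,X)\in\mathit{Act}^*\times\mathcal{P}(\mathit{Act})\mid\exists t:\iota\overset{\rho}{\Longrightarrow}t,\ t\text{ stable},\ X\in\mathsf{refusals}(t)\}$ and $\mathsf{failures}_\bot(\mathcal{L})=\mathsf{failures}(\mathcal{L})\cup\{(\rho,X)\in\mathit{Act}^*\times\mathcal{P}(\mathit{Act})\mid\rho\in\mathsf{divergences}(\mathcal{L})\}$. $\mathcal{L}_1\sqsubseteq_{\mathsf{fdr}}\mathcal{L}_2$ iff $\mathsf{failures}_\bot(\mathcal{L}_2)\subseteq\mathsf{failures}_\bot(\mathcal{L}_1)$ and $\mathsf{divergences}(\mathcal{L}_2)\subseteq\mathsf{divergences}(\mathcal{L}_1)$. The failures-divergences normal form $\mathsf{norm}_{\mathsf{fdr}}(\mathcal{L})$ has states $\mathcal{P}(S)$, initial state $\{s\mid\iota\overset{\epsilon}{\Longrightarrow}s\}$,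 and for $U,V\subseteq S$, $a\in\mathit{Act}$: $U\xrightarrow{a}V$ iff $U$ does not diverge and $V=\{t\mid\exists s\in U: s\overset{a}{\Longrightarrow}t\}$ (no $\tau$-transitions). The product $\mathcal{M}\ltimes\mathcal{L}_2$ of LTSs $\mathcal{M}=(T,\iota_T,\rightarrow_T)$ and $\mathcal{L}_2$ has states $T\times S_2$, initial state $(\iota_T,\iota_2)$, and smallest transition relation with $(u,s)\xrightarrow{\tau}(u,t)$ if $s\xrightarrow{\tau}_2t$, and $(u,s)\xrightarrow{a}(u',t)$ if $u\xrightarrow{a}_Tu'$ and $s\xrightarrow{a}_2t$, for $a\in\mathit{Act}$. A state $(U,s)$ of $\mathsf{norm}_{\mathsf{fdr}}(\mathcal{L}_1)\ltimes\mathcal{L}_2$ is an FD-witness iff $U$ does not diverge and at least one holds: $U=\emptyset$; or $s$ is stable and $\mathsf{refusals}(s)\not\subseteq\mathsf{refusals}(U)$; or $s$ diverges. *)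

(* Defs.v *)
From mathcomp Require Import all_boot.
From mathcomp Require Import classical_sets.

Set Implicit Arguments.
Unset Strict Implicit.
Unset Printing Implicit Defensive.

Local Open Scope classical_set_scope.

(* Act_tau is [option Act]: [None] is the internal action tau and [Some a] is
   the visible action [a].  State spaces are arbitrary, possibly infinite. *)
Record lts (Act : finType) := Lts {
  state :> Type;
  init : state;
  trans : state -> option Act -> state -> Prop
}.

Section LTS.
Context {Act : finType} (L : lts Act).
Implicit Types (s t u : L) (U : set L).

Definition enabled s : set (option Act) := [set a | exists t, trans s a t].

Inductive path_labelled : L -> seq (option Act) -> L -> Prop :=
| path_nil s : path_labelled s [::] s
| path_cons s a u sigma t :
    trans s a u -> path_labelled u sigma t -> path_labelled s (a :: sigma) t.

Definition reachable : set L :=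
  [set s | exists sigma, path_labelled (init L) sigma s].

Inductive weak : L -> seq Act -> L -> Prop :=
| weak_refl s : weak s [::] s
| weak_tau s t : trans s None t -> weak s [::] t
| weak_act s a t : trans s (Some a) t -> weak s [:: a] t
| weak_cat s rho u sigma t :
    weak s rho u -> weak u sigma t -> weak s (rho ++ sigma) t.

Definition stable s : Prop := ~ enabled s None.

(* Meaningful for stable [s] only; all uses below are guarded by [stable]. *)
Definition refusals s : set (set Act) :=
  [set X | X `<=` [set a | ~ enabled s (Some a)]].

Definition set_refusals U : set (set Act) :=
  [set X | exists s, [/\ U s, stable s & refusals s X]].

Definition diverges s : Prop :=
  exists f : nat -> L, f 0 = s /\ forall n, trans (f n) None (f n.+1).

Definition set_diverges U : Prop := exists s, U s /\ diverges s.

Definition divergences : set (seq Act) :=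
  [set w | exists rho sigma,
     w = rho ++ sigma /\ exists t, weak (init L) rho t /\ diverges t].

Definition failures : set (seq Act * set Act) :=
  [set p | exists t, [/\ weak (init L) p.1 t, stable t & refusals t p.2]].

Definition failures_bot : set (seq Act * set Act) :=
  failures `|` [set p | divergences p.1].

Definition norm_fdr_trans (U : set L) (a : option Act) (V : set L) : Prop :=
  if a is Some a then
    ~ set_diverges U /\ V = [set t | exists s, U s /\ weak s [:: a] t]
  else False.

Definition norm_fdr : lts Act :=
  @Lts Act (set L) [set s | weak (init L) [::] s] norm_fdr_trans.

End LTS.

Definition fdr_refines {Act : finType} (L1 L2 : lts Act) : Prop :=
  failures_bot L2 `<=` failures_bot L1 /\ divergences L2 `<=` divergences L1.

Inductive product_trans {Act : finType} (M L : lts Act) :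
    M * L -> option Act -> M * L -> Prop :=
| product_tau u s t :
    trans s None t -> product_trans (u, s) None (u, t)
| product_act u u' s t a :
    trans u (Some a) u' -> trans s (Some a) t ->
    product_trans (u, s) (Some a) (u', t).

Definition product {Act : finType} (M L : lts Act) : lts Act :=
  @Lts Act (M * L)%type (init M, init L) (@product_trans Act M L).

Definition FD_witness {Act : finType} (L1 L2 : lts Act) :
    set (product (norm_fdr L1) L2) :=
  fun w => let: (U, s) := w in
    ~ set_diverges U /\
    [\/ U = set0,
        stable s /\ ~ (refusals s `<=` set_refusals U)
      | diverges s].

Arguments FD_witness {Act} L1 L2 w.

(* Main.v *)
(** A state [(U, s)] with [U] not diverging is reachable in the product exactly
    when, for some trace [r] that is not a divergence of [L1], [s] is reached by
    [r] in [L2] and [U] is the set of all states reached by [r] in [L1].  On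
    such traces [failures_bot L1] and [failures L1] agree, so the last two
    clauses of an FD-witness are direct violations of refinement.  When [U] is
    empty, [s] either diverges or silently reaches a stable state, which yields
    a divergence or a failure that [L1] lacks. *)

Require Import Defs.
From mathcomp Require Import all_boot.
From mathcomp Require Import boolp classical_sets.

Set Implicit Arguments.
Unset Strict Implicit.
Unset Printing Implicit Defensive.

Local Open Scope classical_set_scope.

Notation visible := (pmap id).

Section WeakTransitions.
Context {Act : finType} (L : lts Act).
Implicit Types (s t u : L) (r w : seq Act) (sigma : seq (option Act)).

Lemma path_labelled_cat s sigma u sigma' t :
  path_labelled s sigma u -> path_labelled u sigma' t ->
  path_labelled s (sigma ++ sigma') t.
Proof.
elim=> // {}s a v tau {}u sv _ IH ut /=.
exact: path_cons sv (IH ut).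
Qed.

Lemma path_labelled_weak s sigma t :
  path_labelled s sigma t -> weak s (visible sigma) t.
Proof.
elim=> [{}s|{}s [a|] u {}sigma {}t su _ ut] /=; first exact: weak_refl.
- exact: weak_cat (weak_act su) ut.
- exact: weak_cat (weak_tau su) ut.
Qed.

(** Concatenation is a constructor of [weak], so its derivations have no canonical first step;
    labelled paths do, and support induction step by step. *)
Lemma weakP s w t :
  weak s w t <-> exists2 sigma, path_labelled s sigma t & visible sigma = w.
Proof.
split=> [|[sigma /path_labelled_weak st <-] //].
elim=> [{}s|{}s {}t st|{}s a {}t st|{}s r u {}w {}t _ [p sp <-] _ [q uq <-]].
- by exists [::]; first exact: path_nil.
- by exists [:: None] => //; apply: path_cons st (path_nil _).
- by exists [:: Some a] => //; apply: path_cons st (path_nil _).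
- by exists (p ++ q); [exact: path_labelled_cat sp uq | rewrite pmap_cat].
Qed.

(** An underlying path is cut just before the first visible action after [r], any silent steps there
    going to the first half. *)
Lemma weak_catP s r w t :
  weak s (r ++ w) t <-> exists2 u, weak s r u & weak u w t.
Proof.
split=> [/weakP[sigma st]|[u su ut]]; last exact: weak_cat su ut.
elim: st r => [{}s|{}s [a|] u {}sigma {}t su ut IH] [|b r] //= e.
- by exists s; [exact: weak_refl | rewrite -e; exact: weak_refl].
- exists s; first exact: weak_refl.
  by rewrite -e; apply: weak_cat (weak_act su) (path_labelled_weak ut).
- case: e => <- /IH[v uv vt]; exists v => //.
  exact: weak_cat (weak_act su) uv.
- have [v uv vt] := IH [::] e; exists v => //.
  exact: weak_cat (weak_tau su) uv.
- have [v uv vt] := IH (b :: r) e; exists v => //.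
  exact: weak_cat (weak_tau su) uv.
Qed.

Lemma diverges_or_stabilizes s :
  diverges s \/ exists2 t, weak s [::] t & stable t.
Proof.
have [|unstable] := pselect (exists2 t, weak s [::] t & stable t); first by right.
(* The premise sits under the existential so that [choice] yields a total successor function; states
   not silently reachable from [s] get a dummy value. *)
left; have next t : exists u, weak s [::] t -> trans t None u.
  have [st|] := pselect (weak s [::] t); last by exists t.
  have [[u tu]|stt] := pselect (enabled t None); first by exists u.
  by case: unstable; exists t.
have [g gP] := choice next; exists (fun n => iter n g s); split=> // n /=.
apply: (gP); elim: n => [|n IH] /=; first exact: weak_refl.
exact: weak_cat IH (weak_tau (gP _ IH)).
Qed.

Definition after w : set L := [set t | weak (init L) w t].

Lemma after_rcons r a :
  after (rcons r a) = [set t | exists s, after r s /\ weak s [:: a] t].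
Proof.
apply/seteqP; split=> t; rewrite /after /= -cats1.
- by move/weak_catP=> [u su ut]; exists u.
- by move=> [u [su ut]]; apply/weak_catP; exists u.
Qed.

Lemma set_diverges_after r : set_diverges (after r) -> divergences L r.
Proof.
by move=> [t [rt dt]]; exists r, [::]; rewrite cats0; split=> //; exists t.
Qed.

Lemma divergences_cat r w : divergences L r -> divergences L (r ++ w).
Proof. by move=> [p [q [-> dp]]]; exists p, (q ++ w); rewrite catA. Qed.

Lemma divergences_nil : divergences L [::] -> set_diverges (after [::]).
Proof. by move=> [[|a p] [q [// _ [t [rt dt]]]]]; exists t. Qed.

(** The two cases are whether the prefix that reaches a diverging state is proper or the whole
    trace. *)
Lemma divergences_rcons r a : divergences L (rcons r a) ->
  divergences L r \/ set_diverges (after (rcons r a)).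
Proof.
move=> [p [q]]; case/lastP: q => [|q b] [e [t [pt dt]]].
- by right; exists t; split=> //; rewrite e cats0.
- left; exists p, q; split; last by exists t.
  by move: e; rewrite -rcons_cat => /rcons_inj[].
Qed.

End WeakTransitions.

Arguments after {Act} L w.

Section Product.
Context {Act : finType} (L1 L2 : lts Act).
Implicit Types (r : seq Act) (U V : set L1) (s t : L2).

Local Notation prod := (product (norm_fdr L1) L2).

(* The invariant [divergences L1 r -> set_diverges (after L1 r)] says that no
   proper prefix of [r] diverges: the normal form has no transitions out of a
   diverging set. *)
Lemma product_path_inv r s sigma V t :
  @path_labelled _ prod (after L1 r, s) sigma (V, t) ->
  (divergences L1 r -> set_diverges (after L1 r)) ->
  [/\ V = after L1 (r ++ visible sigma), path_labelled s sigma t &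
      divergences L1 (r ++ visible sigma) -> set_diverges V].
Proof.
elim: sigma r s => [|a sigma IH] r s p.
  by inversion p; subst; rewrite /= cats0; split=> //; exact: path_nil.
inversion p as [|? ? [U' s'] ? ? step rest]; subst => inv.
inversion step as [u ? ? ss|u ? ? ? b us ss]; subst.
  have [-> st dV] := IH _ _ rest inv; split=> //.
  exact: path_cons ss st.
case: us => ndiv eU'; rewrite -after_rcons in eU'; subst U'.
have inv' : divergences L1 (rcons r b) -> set_diverges (after L1 (rcons r b)).
  by move/divergences_rcons => [/inv|].
have := IH _ _ rest inv'; rewrite /= cat_rcons => -[-> st dV]; split=> //.
exact: path_cons ss st.
Qed.

(** Divergences are closed under extension, so no set met along the way diverges and the normal form
    can follow every visible step. *)
Lemma product_path r s sigma t :
  path_labelled s sigma t -> ~ divergences L1 (r ++ visible sigma) ->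
  @path_labelled _ prod (after L1 r, s) sigma
    (after L1 (r ++ visible sigma), t).
Proof.
move=> st; elim: st r => [{}s|{}s [a|] u {}sigma {}t su _ IH] r /= ndiv.
- by rewrite cats0; exact: path_nil.
- rewrite -cat_rcons in ndiv *; apply: path_cons (IH _ ndiv).
  apply: product_act su; split; last exact: after_rcons.
  move/set_diverges_after => dr; apply: ndiv.
  by rewrite cat_rcons; exact: divergences_cat.
- by apply: path_cons (IH _ ndiv); exact: product_tau.
Qed.

Lemma reachable_nondivergentP U s :
  @reachable _ prod (U, s) /\ ~ set_diverges U <->
  exists r, [/\ U = after L1 r, weak (init L2) r s & ~ divergences L1 r].
Proof.
split=> [[[sigma p] ndiv]|[_ [-> /weakP[sigma p <-] ndiv]]].
- have [eU st dU] := product_path_inv (r := [::]) p (@divergences_nil _ L1).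
  exists (visible sigma); split=> //; first exact: path_labelled_weak.
  by move/dU.
- split; last by move/set_diverges_after.
  by exists sigma; exact: (product_path (r := [::])).
Qed.

End Product.

Lemma failures_bot_nondivergent (Act : finType) (L : lts Act) r X :
  ~ divergences L r ->
  failures_bot L (r, X) <-> set_refusals (after L r) X.
Proof. by move=> ndiv; split=> [[]|] //; left. Qed.

Theorem theorem3p24 (Act : finType) (L1 L2 : lts Act) :
  fdr_refines L1 L2 <->
  ~ exists w : product (norm_fdr L1) L2,
      reachable w /\ FD_witness L1 L2 w.
Proof.
split=> [[subF subD] [[U s] [reach [ndivU wit]]]|nowit].
- have [r [eU rs ndiv]] := (reachable_nondivergentP U s).1 (conj reach ndivU).
  (* A diverging [t] would make [r] a divergence of [L2], hence of [L1]. *)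
  have ndiv_state t : weak (init L2) r t -> ~ diverges t.
    by move=> rt dt; apply/ndiv/subD/set_diverges_after; exists t.
  case: wit => [U0|[sts]|]; last exact: ndiv_state.
  + have [/(ndiv_state _ rs)//|[t st stt]] := diverges_or_stabilizes s.
    have rt : weak (init L2) r t by rewrite -[r]cats0; exact: weak_cat rs st.
    (* Every stable state refuses [set0], whereas an empty [after L1 r] has no refusals at all. *)
    have /subF/(failures_bot_nondivergent _ ndiv) : failures_bot L2 (r, set0).
      by left; exists t; split=> // a.
    by rewrite -eU U0 => -[? []].
  + apply=> X sX; rewrite eU; apply/failures_bot_nondivergent => //.
    by apply: subF; left; exists s.
- have nowit_after r s : weak (init L2) r s -> ~ divergences L1 r ->
      ~ [\/ after L1 r = set0,
          stable s /\ ~ (refusals s `<=` set_refusals (after L1 r))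
        | diverges s].
    move=> rs ndiv wit; apply: nowit; exists (after L1 r, s).
    have [|reach ndivU] := (reachable_nondivergentP (after L1 r) s).2.
      by exists r.
    by split.
  have subD : divergences L2 `<=` divergences L1.
    (* Only the prefix [r] leading to the diverging [t] matters: were it not a divergence of [L1],
       then [(after L1 r, t)] would be a witness. *)
    move=> _ [r [w [-> [t [rt dt]]]]]; apply: divergences_cat.
    by apply: contrapT => /(nowit_after _ _ rt); apply; constructor 3.
  split=> // -[r X] [[t [/= rt stt tX]]|/subD]; last by right.
  have [|ndiv] := pselect (divergences L1 r); first by right.
  apply/failures_bot_nondivergent => //; apply: contrapT => nX.
  by apply: (nowit_after _ _ rt ndiv); constructor 2; split=> // /(_ X tX).
Qed.
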